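(* There is an absolute constant $c>0$ such that the following holds. For every real $0<\alpha<1$ and every infinite sequence $\mathcal{A}$ of positive integers with $d^{*}(\mathcal{A})>\alpha$, writing $\mathcal{B}=\mathcal{A}\cdot\mathcal{A}=\{b_1<b_2<\cdots\}$, we have $b_{n+1}-b_n\le c\,\alpha^{-3}$ for infinitely many $n$.
   Context: For an infinite set $\mathcal{A}$ of positive integers, the upper Banach density is $d^{*}(\mathcal{A})=\limsup_{|I|\to\infty}\frac{|\mathcal{A}\cap I|}{|I|}$, where $I$ runs through all intervals of integers. The product set $\mathcal{A}\cdot\mathcal{A}$ is the set of all products $a_ia_j$ with $a_i,a_j\in\mathcal{A}$, and $b_1<b_2<\cdots$ denotes its elements in increasing order. *)

(* Defs.v *)
From HB Require Import structures.
From mathcomp Require Import all_boot all_order all_algebra.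
From mathcomp Require Import finmap.
From mathcomp Require Import all_classical all_reals all_analysis.

Set Implicit Arguments.
Unset Strict Implicit.
Unset Printing Implicit Defensive.

Import Order.TTheory GRing.Theory Num.Theory.

Local Open Scope classical_set_scope.
Local Open Scope ring_scope.

(* The pair (m, l) encodes the integer interval {m, ..., m + l - 1}, which has
   l elements. *)
Definition int_interval (I : int * nat) : set int :=
  [set k | I.1 <= k < I.1 + I.2%:Z].

Definition interval_density (R : realType) (A : set int) (I : int * nat) : R :=
  #|` fset_set (A `&` int_interval I)|%:R / I.2%:R.

(* The limit superior as |I| tends to infinity, written out because limf_esup
   expects a filtered type of indices, which int * nat is not. The division by
   zero on intervals of length 0 does not affect it. *)
Definition upper_banach_density (R : realType) (A : set int) : \bar R :=
  ereal_inf [set ereal_sup [set (interval_density R A I)%:E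
                           | I in [set I | (N <= I.2)%N]]
            | N in [set: nat]].

Definition product_set (A B : set int) : set int :=
  [set a * b | a in A & b in B].

(* Indices start at 0: b 0 is the least element of B. *)
Definition increasing_enumeration (B : set int) (b : nat -> int) : Prop :=
  {homo b : i j / (i < j)%N >-> i < j} /\ range b = B.

(* Main.v *)
(* If [a], [a + d], [b], [b + d] all lie in [A] then [b (a + d)] and
   [a (b + d)] are products differing by [d (b - a)]. In a long interval of
   density more than [alpha], at least a constant proportion of the elements of
   [A] have another element of [A] at distance [d = O(alpha^-1)] to their right;
   by pigeonhole over [d] and over blocks of length [O(alpha^-2)], two of them,
   in the same block, share the same [d]. Discarding the small elements of [A]
   first makes the products arbitrarily large. *)
Require Import Defs.
From mathcomp Require Import all_boot all_order all_algebra.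
From mathcomp Require Import finmap zify ring lra.
From mathcomp Require Import all_classical all_reals all_analysis.

Import Order.TTheory GRing.Theory Num.Theory.

Local Open Scope classical_set_scope.
Local Open Scope ring_scope.

(* Elements of [s] without a successor within distance [G] occupy distinct
   blocks of length [G]; the others are classified by a gap at most [G] and a
   block of length [W]. *)
Lemma repeated_gap (G W l : nat) (s : seq nat) :
  (0 < G)%N -> (0 < W)%N -> uniq s -> {in s, forall a, (a < l)%N} ->
  ((l %/ G).+1 + G * (l %/ W).+1 < size s)%N ->
  exists a b d : nat, [/\ (a < b < a + W)%N, (0 < d <= G)%N &
    [/\ a \in s, b \in s, a + d \in s & b + d \in s]%N].
Proof.
move=> G0 W0 us sl sz.
(* One less than the distance from [a] to the next element of [s]; [find] returns [G] when there is
   none within distance [G]. *)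
pose gap a := find (fun k => a + k.+1 \in s)%N (iota 0 G).
have gapS a : (gap a < G)%N -> (a + (gap a).+1)%N \in s.
  move=> ga; have hs : has (fun k => a + k.+1 \in s)%N (iota 0 G).
    by rewrite has_find size_iota.
  by have := nth_find 0%N hs; rewrite nth_iota.
have gap_le a : (gap a <= G)%N.
  by rewrite -[X in (_ <= X)%N](size_iota 0 G) find_size.
have gapG a k : gap a = G -> (k < G)%N -> (a + k.+1)%N \notin s.
  move=> ga kG; have := @before_find _ 0%N (fun k => a + k.+1 \in s)%N (iota 0 G) k.
  by rewrite -/(gap a) ga nth_iota // => /(_ kG) ->.
(* The first component tells the two kinds apart, so blocks of length [G] and of length [W] are
   never confused. The values lie in [t], which is shorter than [s]. *)
pose f a := (gap a, a %/ (if gap a == G then G else W))%N.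
pose t := [seq (d, q) | d <- iota 0 G, q <- iota 0 (l %/ W).+1] ++
          [seq (G, q) | q <- iota 0 (l %/ G).+1].
have sub_t : {subset [seq f a | a <- s] <= t}.
  move=> _ /mapP[a /sl al ->]; rewrite mem_cat; apply/orP.
  rewrite /f; case: eqVneq => [->|ga].
    by right; apply: map_f; rewrite mem_iota /= add0n ltnS leq_div2r // ltnW.
  left; apply: allpairs_f; rewrite mem_iota /= add0n.
    by rewrite ltn_neqAle ga gap_le.
  by rewrite ltnS leq_div2r // ltnW.
have Nuf : ~~ uniq [seq f a | a <- s].
  apply: contraL sz => uf; rewrite -leqNgt -(size_map f).
  apply: leq_trans (uniq_leq_size uf sub_t) _.
  by rewrite size_cat size_allpairs size_map !size_iota addnC.
have close a b : (a < b)%N -> f a = f b -> a \in s -> b \in s ->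
    exists a b d : nat, [/\ (a < b < a + W)%N, (0 < d <= G)%N &
      [/\ a \in s, b \in s, a + d \in s & b + d \in s]%N].
  move=> ab [gab]; rewrite -gab => qab as_ bs.
  have near D : (0 < D -> a %/ D = b %/ D -> b < a + D)%N.
    move=> D0 e; apply: leq_trans (ltn_ceil b D0) _.
    by rewrite -e mulSn addnC leq_add2r leq_trunc_div.
  (* If [gap a = G], the common block puts [b] itself within distance [G] after [a], a
     contradiction. *)
  case: (eqVneq (gap a) G) qab => [ga|ga] qab.
    have bE : b = (a + (b - a).-1.+1)%N by lia.
    have bG := near _ G0 qab.
    have /negP[] := gapG a (b - a).-1 ga ltac:(lia).
    by rewrite -bE.
  have ga' : (gap a < G)%N by rewrite ltn_neqAle ga gap_le.
  exists a, b, (gap a).+1; split; [by rewrite ab near | by [] |].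
  by split=> //; [exact: gapS | rewrite gab; apply: gapS; rewrite -gab].
have [i [j [ij js fij]]] : exists i j, [/\ (i < j)%N, (j < size s)%N &
   f (nth 0%N s i) = f (nth 0%N s j)].
  have /(uniqPn (0, 0)%N)[i [j [ij]]] := Nuf; rewrite size_map => js.
  by rewrite !(nth_map 0%N) ?(ltn_trans ij) // => e; exists i, j.
have is_ := ltn_trans ij js.
have [lt|gt|/eqP] := ltngtP (nth 0%N s i) (nth 0%N s j).
- exact: close lt fij (mem_nth _ is_) (mem_nth _ js).
- exact: close gt (esym fij) (mem_nth _ js) (mem_nth _ is_).
- by rewrite nth_uniq // (ltn_eqF ij).
Qed.

(** Elements are recorded by their offset from the left end [m], so that the counting takes place in
    [nat]. *)
Lemma dense_interval (R : realType) (A : set int) (alpha : R) (N : nat) :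
  (alpha%:E < upper_banach_density R A)%E ->
  exists (m : int) (l : nat) (s : seq nat),
    [/\ (N < l)%N, uniq s, alpha * l%:R < (size s)%:R,
        {in s, forall k, (k < l)%N} & {in s, forall k, A (m + k%:Z)}].
Proof.
(* The term of index [N.+1] of the infimum also ensures [0 < l], so the density can be multiplied
   out. *)
move=> /lt_le_trans/(_ (ereal_inf_lbound (imageT _ N.+1)))/ereal_sup_gt[].
move=> _ [[m l] /= Nl <-]; rewrite lte_fin /interval_density /=.
set X := A `&` _; rewrite ltr_pdivlMr ?ltr0n ?(leq_trans _ Nl)// => dens.
(* [fset_set] is empty on infinite sets, so membership can be read off only once [X] is finite. *)
have finX : finite_set X.
  apply: (@sub_finite_set _ _ [set` [seq m + k%:Z | k <- iota 0 l]]).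
    move=> x [_]; rewrite /int_interval /= => mx.
    apply/mapP; exists `|x - m|%N; last by lia.
    by rewrite mem_iota; lia.
  by apply/finite_seqP; eexists.
have inX x : x \in fset_set X -> A x /\ (m <= x < m + l%:Z).
  by rewrite in_fset_set // => /set_mem.
exists m, l, [seq `|x - m|%N | x <- enum_fset (fset_set X)]; split => //.
- rewrite map_inj_in_uniq ?fset_uniq // => x y /inX[_ mx] /inX[_ my].
  by move=> /(congr1 Posz); lia.
- by rewrite size_map.
- by move=> _ /mapP[x /inX[_ mx] ->]; lia.
- move=> _ /mapP[x /inX[Ax mx] ->].
  by have -> : m + `|x - m|%N%:Z = x by lia.
Qed.

(** The discarded offsets give distinct integers between 1 and [M]. *)
Lemma size_filter_gt (m : int) (M : nat) (s : seq nat) :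
  uniq s -> {in s, forall k, 0 < m + k%:Z} ->
  (size s <= M + size [seq k <- s | (M%:Z < m + k%:Z)%R])%N.
Proof.
move=> us s0; rewrite size_filter -(count_predC (fun k : nat => M%:Z < m + k%:Z) s).
rewrite addnC leq_add2r -size_filter.
rewrite -(size_map (fun k : nat => `|(m + k%:Z)%R|%N)) -[leqRHS](size_iota 1 M).
apply: uniq_leq_size => [|_ /mapP[k ks ->]].
  rewrite map_inj_in_uniq ?filter_uniq // => i j.
  by rewrite !mem_filter => /andP[_ /s0 i0] /andP[_ /s0 j0]; lia.
by move: ks; rewrite mem_filter mem_iota => /andP[/= kM /s0 k0]; lia.
Qed.

(** The sizes of [G] and [W] make [l / G] and [G * l / W] at most [alpha * l / 4] each. The other
    half of [alpha * l] absorbs the constant [M + G + 1] once [l] is large, which fixes [N]. *)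
Lemma repeated_gap_int (R : realType) (A : set int) (alpha : R) (G W M : nat) :
  0 < alpha -> 4 / alpha <= G%:R -> 4 / alpha * G%:R <= W%:R ->
  (forall a : int, A a -> 0 < a) ->
  (alpha%:E < upper_banach_density R A)%E ->
  exists a b d : int,
    [/\ M%:Z < a, a < b < a + W%:Z, 0 < d <= G%:Z,
      A a /\ A b & A (a + d) /\ A (b + d)].
Proof.
move=> alpha0 leG leW A0 dens.
pose N := Num.truncn (2 / alpha * (M + G).+1%:R).
have [m [l [s [Nl us ls sl sA]]]] := dense_interval _ _ _ N dens.
have s0 : {in s, forall k, 0 < m + k%:Z} by move=> k /sA/A0.
have G0 : (0 < G)%N.
  by rewrite -(@ltr_nat R); apply: lt_le_trans leG; rewrite divr_gt0.
have W0 : (0 < W)%N.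
  rewrite -(@ltr_nat R); apply: lt_le_trans leW.
  by rewrite mulr_gt0 ?divr_gt0 // ltr0n.
have alphaG : 4 <= alpha * G%:R by rewrite mulrC -ler_pdivrMr.
have alphaW : 4 * G%:R <= alpha * W%:R.
  by move: leW; rewrite mulrAC ler_pdivrMr // [leRHS]mulrC.
have Nl' : 2 * (M + G).+1%:R <= alpha * l%:R.
  have /ltW : 2 / alpha * (M + G).+1%:R < l%:R.
    apply: (lt_le_trans (truncnS_gt _)).
    by rewrite ler_nat.
  by rewrite mulrAC ler_pdivrMr // [leRHS]mulrC.
have divG : (l %/ G)%:R * 4 <= alpha * l%:R.
  apply: (@le_trans _ _ ((l %/ G)%:R * (alpha * G%:R))).
    by rewrite ler_wpM2l.
  rewrite mulrCA ler_pM2l // -natrM ler_nat; exact: leq_trunc_div.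
have divW : (l %/ W)%:R * (4 * G%:R) <= alpha * l%:R.
  apply: (@le_trans _ _ ((l %/ W)%:R * (alpha * W%:R))).
    by rewrite ler_wpM2l.
  rewrite mulrCA ler_pM2l // -natrM ler_nat; exact: leq_trunc_div.
pose t := [seq k <- s | M%:Z < m + k%:Z].
have szt : ((l %/ G).+1 + G * (l %/ W).+1 < size t)%N.
  rewrite -(ltn_add2l M); apply: (leq_trans _ (size_filter_gt m M s us s0)).
  rewrite -(@ltr_nat R); apply: le_lt_trans ls.
  move: Nl'; rewrite !natrD natrM -!natr1 natrD; nra.
have ut : uniq t by rewrite filter_uniq.
have tl : {in t, forall a, (a < l)%N} by move=> a; rewrite mem_filter => /andP[_ /sl].
have tA k : k \in t -> M%:Z < m + k%:Z /\ A (m + k%:Z).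
  by rewrite mem_filter => /andP[? /sA].
have [a [b [d [abW dG [/tA[Ma Aa] /tA[_ Ab] /tA[_ Ad] /tA[_ Bd]]]]]] :=
  repeated_gap G W l t G0 W0 ut tl szt.
exists (m + a%:Z), (m + b%:Z), d%:Z; rewrite -!addrA; split => //.
by move: abW; clear; lia.
Qed.

(** The elements [x] and [y] need not be consecutive: if [x = b i], then [b i.+1 <= y], so the gap
    following [x] is at most [D] too. *)
Lemma infinite_small_gaps (R : numDomainType) (B : set int) (b : nat -> int) (D : R) :
  increasing_enumeration B b ->
  (forall M : nat, exists x y : int,
    [/\ B x, B y, M%:Z < x, x < y & (y - x)%:~R <= D]) ->
  infinite_set [set n : nat | (b n.+1 - b n)%:~R <= D].
Proof.
move=> [incb <-] gaps /finite_seqP[s sE].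
have lebE i j : (b i <= b j) = (i <= j)%N by exact: (le_mono incb).
have ltbE i j : (b i < b j) = (i < j)%N.
  by rewrite !ltNge lebE -ltnNge.
(* This bound forces [i] beyond every index in the supposedly finite list [s]. *)
have [_ [_ [[i _ <-] [j _ <-] Mi ij Dij]]] := gaps `|b (\max_(k <- s) k)|%N.
have /= : i \in s.
  suff : [set` s] i by [].
  rewrite -sE /=; apply: le_trans Dij.
  by rewrite ler_int lerD2r lebE -ltbE.
move=> si; have : (i <= \max_(k <- s) k)%N by rewrite leq_bigmax_seq.
by rewrite -lebE; lia.
Qed.

Theorem theorem1 (R : realType) :
  exists c : R, 0 < c /\
    forall (alpha : R) (A : set int) (b : nat -> int),
      0 < alpha -> alpha < 1 ->
      (forall a : int, A a -> 0 < a) ->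
      infinite_set A ->
      (alpha%:E < upper_banach_density R A)%E ->
      increasing_enumeration (product_set A A) b ->
      infinite_set [set n : nat | (b n.+1 - b n)%:~R <= c * alpha ^- 3].
Proof.
(* [105 = 5 * 21], from [G <= 5 / alpha] and [W <= 21 / alpha ^+ 2]; since [1 <= alpha^-1], rounding
   up costs at most one more unit in each numerator. *)
exists 105; split=> // alpha A b alpha0 alpha1 A0 _ dens enumb.
apply: infinite_small_gaps enumb _ => M.
pose G := (Num.truncn (4 / alpha)).+1.
pose W := (Num.truncn (4 / alpha * G%:R)).+1.
have ia1 : 1 <= alpha^-1 by rewrite invf_ge1 // ltW.
have leG : 4 / alpha <= G%:R by rewrite ltW // truncnS_gt.
have leW : 4 / alpha * G%:R <= W%:R by rewrite ltW // truncnS_gt.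
have geG : G%:R <= 5 / alpha.
  rewrite -[leLHS]natr1; apply: (@le_trans _ _ (4 / alpha + 1)); last lra.
  by rewrite lerD2r truncn_le divr_ge0 // ltW.
have geW : W%:R <= 21 / alpha ^+ 2.
  rewrite -[leLHS]natr1; apply: (@le_trans _ _ (4 / alpha * G%:R + 1)).
    by rewrite lerD2r truncn_le mulr_ge0 // divr_ge0 // ltW.
  rewrite -exprVn; nra.
have [x [y [d [Mx xyW dG [Ax Ay] [Axd Ayd]]]]] :=
  repeated_gap_int R A alpha G W M alpha0 leG leW A0 dens.
have diff : y * (x + d) - x * (y + d) = d * (y - x) by ring.
exists (x * (y + d)), (y * (x + d)); split.
- by exists x => //; exists (y + d).
- by exists y => //; exists (x + d).
(* The factor [y + d] is a positive integer, so the product is at least [x]. *)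
- apply: (lt_le_trans Mx); apply: ler_peMr; first by rewrite ltW ?A0.
  by move: (A0 _ Ayd); clear; lia.
- by rewrite -subr_gt0 diff mulr_gt0 // ?subr_gt0; [case/andP: dG | case/andP: xyW].
rewrite diff.
apply: (@le_trans _ _ ((G * W)%:R)).
  rewrite -[leRHS]/((G * W)%:Z%:~R) ler_int PoszM.
  move: xyW dG => /andP[xy yxW] /andP[d0 dG].
  by rewrite ler_pM // ?lerBlDl ?subr_ge0 ltW.
rewrite natrM; apply: (le_trans (ler_pM _ _ geG geW)) => //.
rewrite le_eqVlt; apply/orP; left; apply/eqP; field.
by rewrite gt_eqF.
Qed.
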